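(* There exist $n,m$, $C\in\mathbb S^n$, a linear map $\mathcal A:\mathbb S^n\to\mathbb R^m$ and $b\in\mathbb R^m$ such that for any $\rho>0$ there is a family $(y_\epsilon)_{\epsilon\in[0,\rho)}$ of optimal solutions of (D) for which the augmented Lagrangian $\mathcal L_\rho(\cdot,y_\epsilon)$ has a quadratic growth constant for each $\epsilon\in(0,\rho)$ that diminishes to $0$ as $\epsilon\to0$, and for which the quadratic growth condition fails at $\epsilon=0$. That is, for $B$ larger than the nuclear norm of the minimizer, with $\gamma_B(\epsilon)$ denoting the best quadratic growth constant of $\mathcal L_\rho(\cdot,y_\epsilon)$: $\gamma_B(\epsilon)>0$ for $\epsilon\in(0,\rho)$, $\gamma_B(\epsilon)\to0$ as $\epsilon\to0$, and no $\gamma>0$ is a quadratic growth constant for $\epsilon=0$.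
   Context: $\mathbb S^n$: real symmetric $n\times n$ matrices with the trace inner product. $\mathcal A^*$ is the adjoint of $\mathcal A$. (P): minimize $\langle C,X\rangle$ subject to $\mathcal AX=b$, $X\succeq0$. (D): maximize $\langle b,y\rangle$ subject to $C-\mathcal A^*y\succeq0$. $\mathcal L_\rho(X,y)=\langle C,X\rangle+\langle y,b-\mathcal AX\rangle+\frac\rho2\|\mathcal AX-b\|_2^2$, and the ALM subproblem is to minimize $\mathcal L_\rho(\cdot,y)$ over $X\succeq0$. Given $y$ for which the ALM subproblem has a unique minimizer $X_{y,\rho}$ and given $B$, a number $\gamma>0$ is a quadratic growth constant if $\mathcal L_\rho(X,y)-\mathcal L_\rho(X_{y,\rho},y)\ge\gamma\|X-X_{y,\rho}\|_F^2$ for all $X\succeq0$ with nuclear norm $\|X\|_*\le B$; the best constant is the supremum of such $\gamma$. The quadratic growth condition fails if no such $\gamma>0$ exists. For the family in the claim the minimizer is unique for every $\epsilon\in[0,\rho)$. *)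

(* Defs.v *)
From HB Require Import structures.
From mathcomp Require Import all_boot all_order all_algebra.
From mathcomp Require Import polyrcf.
From mathcomp Require Import all_classical all_reals all_analysis.

Set Implicit Arguments.
Unset Strict Implicit.
Unset Printing Implicit Defensive.

Import Order.TTheory GRing.Theory Num.Theory.
Import numFieldNormedType.Exports.
Local Open Scope classical_set_scope.
Local Open Scope ring_scope.

Definition is_symmx (R : realType) (n : nat) : {pred 'M[R]_n} :=
  fun X => X^T == X.
Arguments is_symmx : clear implicits.

Lemma is_symmx_submod_closed (R : realType) (n : nat) :
  submod_closed (is_symmx R n).
Proof.
split=> [|a X Y]; rewrite !unfold_in ?trmx0 // => /eqP XT /eqP YT.
by rewrite linearP /= XT YT.
Qed.

HB.instance Definition _ (R : realType) (n : nat) :=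
  GRing.isSubmodClosed.Build R 'M[R]_n (is_symmx R n)
    (is_symmx_submod_closed R n).

(* The real vector space S^n. *)
Record symmx (R : realType) (n : nat) := SymMx {
  symmx_val :> 'M[R]_n;
  symmx_valP : symmx_val \in is_symmx R n }.

HB.instance Definition _ (R : realType) (n : nat) :=
  [isSub for @symmx_val R n].
HB.instance Definition _ (R : realType) (n : nat) :=
  [Choice of symmx R n by <:].
HB.instance Definition _ (R : realType) (n : nat) :=
  [SubChoice_isSubLmodule of symmx R n by <:].

Definition sympart (R : realType) (n : nat) (X : 'M[R]_n) : 'M[R]_n :=
  2^-1 *: (X + X^T).

Lemma sympart_sym (R : realType) (n : nat) (X : 'M[R]_n) :
  sympart X \in is_symmx R n.
Proof. by rewrite unfold_in /sympart linearZ linearD /= trmxK addrC. Qed.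

Definition to_symmx (R : realType) (n : nat) (X : 'M[R]_n) : symmx R n :=
  SymMx (sympart_sym X).

Definition dotv (R : realType) (m : nat) (u v : 'cV[R]_m) : R :=
  \sum_i u i 0 * v i 0.

Definition norm2 (R : realType) (m : nat) (u : 'cV[R]_m) : R :=
  Num.sqrt (dotv u u).

Definition trip (R : realType) (n : nat) (X Y : symmx R n) : R :=
  \tr (X *m Y).

Definition frobnorm (R : realType) (n : nat) (X : symmx R n) : R :=
  Num.sqrt (trip X X).

Definition psd (R : realType) (n : nat) (X : symmx R n) : Prop :=
  forall v : 'cV[R]_n, 0 <= (v^T *m X *m v) 0 0.

(* Sum of the singular values of X: the square roots of the eigenvalues of
   X^T X, each counted with its multiplicity in the characteristic polynomial
   (which splits over R with nonnegative roots). *)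
Definition nucnorm (R : realType) (n : nat) (X : 'M[R]_n) : R :=
  let p := char_poly (X^T *m X) in
  \sum_(s <- rootsR p) Num.sqrt s *+ mup s p.

(* The symmetric matrix representing X |-> <A X, y> for the trace inner
   product: its (i, j) entry is the value at (E_ij + E_ji) / 2; see adjointP. *)
Definition adjoint_mx (R : realType) (n m : nat)
    (A : {linear symmx R n -> 'cV[R]_m}) (y : 'cV[R]_m) : 'M[R]_n :=
  \matrix_(i, j) dotv (A (to_symmx (delta_mx i j))) y.

Lemma adjoint_mx_sym (R : realType) (n m : nat)
    (A : {linear symmx R n -> 'cV[R]_m}) (y : 'cV[R]_m) :
  adjoint_mx A y \in is_symmx R n.
Proof.
rewrite unfold_in; apply/eqP/matrixP => i j; rewrite !mxE.
congr (dotv (A _) y); apply: val_inj => /=.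
by rewrite /sympart !trmx_delta addrC.
Qed.

Definition adjoint (R : realType) (n m : nat)
    (A : {linear symmx R n -> 'cV[R]_m}) (y : 'cV[R]_m) : symmx R n :=
  SymMx (adjoint_mx_sym A y).

Lemma symmx_val_sum (R : realType) (n : nat) (I : Type) (r : seq I)
    (F : I -> symmx R n) :
  symmx_val (\sum_(i <- r) F i) = \sum_(i <- r) symmx_val (F i).
Proof. exact: (big_morph (@symmx_val R n)). Qed.

Lemma symmx_sumE (R : realType) (n : nat) (X : symmx R n) :
  X = \sum_i \sum_j X i j *: to_symmx (delta_mx i j).
Proof.
have XT : (symmx_val X)^T = symmx_val X by apply/eqP; exact: (symmx_valP X).
apply: val_inj => /=; rewrite symmx_val_sum; apply/matrixP => k l.
transitivity (sympart X k l).
  by rewrite /sympart XT !mxE -mulr2n -[X in _ * X]mulr_natl mulKf ?pnatr_eq0.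
rewrite /sympart {1 2}(matrix_sum_delta (symmx_val X))
  linear_sum -big_split /= scaler_sumr.
congr (fun_of_matrix _ k l); apply: eq_bigr => i _.
rewrite symmx_val_sum linear_sum -big_split /= scaler_sumr.
by apply: eq_bigr => j _; rewrite linearZ /= -scalerDr scalerA mulrC -scalerA.
Qed.

Lemma adjointP (R : realType) (n m : nat)
    (A : {linear symmx R n -> 'cV[R]_m}) (X : symmx R n) (y : 'cV[R]_m) :
  trip X (adjoint A y) = dotv (A X) y.
Proof.
rewrite {2}(symmx_sumE X) linear_sum /=.
have -> : dotv (\sum_i A (\sum_j X i j *: to_symmx (delta_mx i j))) y =
    \sum_i \sum_j X i j * dotv (A (to_symmx (delta_mx i j))) y.
  rewrite /dotv; under eq_bigr => k _ do rewrite summxE mulr_suml.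
  rewrite exchange_big; apply: eq_bigr => i _ /=.
  under eq_bigr => k _ do rewrite linear_sum summxE mulr_suml.
  rewrite exchange_big; apply: eq_bigr => j _ /=.
  rewrite mulr_sumr; apply: eq_bigr => k _.
  by rewrite linearZ mxE mulrA.
rewrite /trip /mxtrace; apply: eq_bigr => i _; rewrite mxE.
apply: eq_bigr => j _; congr (_ * _) => /=.
have /eqP <- : (adjoint_mx A y)^T == adjoint_mx A y by exact: adjoint_mx_sym.
by rewrite !mxE.
Qed.

Definition dual_feasible (R : realType) (n m : nat) (C : symmx R n)
    (A : {linear symmx R n -> 'cV[R]_m}) (y : 'cV[R]_m) : Prop :=
  psd (C - adjoint A y).

Definition dual_optimal (R : realType) (n m : nat) (C : symmx R n)
    (A : {linear symmx R n -> 'cV[R]_m}) (b y : 'cV[R]_m) : Prop :=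
  dual_feasible C A y /\
  forall y' : 'cV[R]_m, dual_feasible C A y' -> dotv b y' <= dotv b y.

Definition auglag (R : realType) (n m : nat) (C : symmx R n)
    (A : {linear symmx R n -> 'cV[R]_m}) (b : 'cV[R]_m) (rho : R)
    (X : symmx R n) (y : 'cV[R]_m) : R :=
  trip C X + dotv y (b - A X) + rho / 2 * norm2 (A X - b) ^+ 2.

Definition alm_minimizer (R : realType) (n m : nat) (C : symmx R n)
    (A : {linear symmx R n -> 'cV[R]_m}) (b : 'cV[R]_m) (rho : R)
    (y : 'cV[R]_m) (X : symmx R n) : Prop :=
  psd X /\
  forall Z : symmx R n, psd Z ->
    auglag C A b rho X y <= auglag C A b rho Z y.

Definition alm_unique_minimizer (R : realType) (n m : nat) (C : symmx R n)
    (A : {linear symmx R n -> 'cV[R]_m}) (b : 'cV[R]_m) (rho : R)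
    (y : 'cV[R]_m) (X : symmx R n) : Prop :=
  alm_minimizer C A b rho y X /\
  forall Z : symmx R n, alm_minimizer C A b rho y Z -> Z = X.

(* Xs is meant to be the unique minimizer X_{y,rho}. *)
Definition qg_constant (R : realType) (n m : nat) (C : symmx R n)
    (A : {linear symmx R n -> 'cV[R]_m}) (b : 'cV[R]_m) (rho : R)
    (y : 'cV[R]_m) (Xs : symmx R n) (B gamma : R) : Prop :=
  0 < gamma /\
  forall X : symmx R n, psd X -> nucnorm X <= B ->
    gamma * frobnorm (X - Xs) ^+ 2 <=
    auglag C A b rho X y - auglag C A b rho Xs y.

(* Supremum in the extended reals: -oo when there is no quadratic growth
   constant, so it is positive exactly when there is one. *)
Definition best_qg_constant (R : realType) (n m : nat) (C : symmx R n)
    (A : {linear symmx R n -> 'cV[R]_m}) (b : 'cV[R]_m) (rho : R)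
    (y : 'cV[R]_m) (Xs : symmx R n) (B : R) : \bar R :=
  ereal_sup [set gamma%:E | gamma in qg_constant C A b rho y Xs B].

(* Main.v *)
Require Import Defs.
From HB Require Import structures.
From mathcomp Require Import all_boot all_order all_algebra.
From mathcomp Require Import polyrcf ring lra.
From mathcomp Require Import all_classical all_reals all_analysis.

(** Take C = 0, A [[x, z], [z, w]] = (x, w), b = (1, 0) and
    y_eps = (0, - eps).  Then
      L_rho (X, y_eps) = eps w + rho / 2 ((x - 1)^2 + w^2),
    whose only zero on the positive semidefinite cone is X = E_11, since w = 0
    forces z = 0.  The off-diagonal entry is controlled only through
    z^2 <= x w <= B w, so it is paid for by the linear term eps w alone: the best
    growth constant is positive for eps > 0 and at most eps / 2. *)

Set Implicit Arguments.
Unset Strict Implicit.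
Unset Printing Implicit Defensive.

Import Order.TTheory GRing.Theory Num.Theory.
Import numFieldNormedType.Exports.
Local Open Scope classical_set_scope.
Local Open Scope ring_scope.

(** * Sums over polynomial roots counted with multiplicity *)

(** [rootsR] lists each root once, and the multiplicity of a root is its number of occurrences in
    [s], so the left side regroups [s] into blocks of equal elements. This evaluates [nucnorm] once
    the characteristic polynomial is split. *)
Lemma sum_rootsR_prod_XsubC (R : rcfType) (s : seq R) (F : R -> R) :
  let p := \prod_(a <- s) ('X - a%:P) in
  \sum_(a <- rootsR p) F a *+ mup a p = \sum_(a <- s) F a.
Proof.
move=> p; have p0 : p != 0 by rewrite monic_neq0 ?monic_prod_XsubC.
have rp : perm_eq (rootsR p) (undup s).
  apply: uniq_perm; rewrite ?undup_uniq ?uniq_roots // => x.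
  by rewrite -(roots_on_rootsR p0) in_itv /= root_prod_XsubC mem_undup.
rewrite (perm_big _ rp) /= -[RHS](perm_big _ (perm_count_undup s)) /=.
rewrite big_flatten big_map; apply: eq_bigr => a _.
by rewrite big_nseq iter_addr_0 mu_prod_XsubC.
Qed.

(** * Symmetric matrices of order two: semidefiniteness and norms *)

Lemma lift00 : lift ord0 ord0 = 1 :> 'I_2.
Proof. exact: val_inj. Qed.

Lemma det_mx22 (R : comPzRingType) (M : 'M[R]_2) :
  \det M = M 0 0 * M 1 1 - M 0 1 * M 1 0.
Proof.
rewrite (expand_det_row _ 0) !big_ord_recl big_ord0 /cofactor !det_mx11 !mxE /=.
rewrite lift00; have -> : lift 1 0 = 0 :> 'I_2 by apply: val_inj.
by rewrite !add0n addr0 expr0 expr1 mul1r mulN1r mulrN.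
Qed.

Lemma mxtrace2 (R : pzRingType) (M : 'M[R]_2) : \tr M = M 0 0 + M 1 1.
Proof.
by rewrite /mxtrace !big_ord_recl big_ord0 addr0 lift00.
Qed.

Lemma char_poly_mx22 (R : comNzRingType) (M : 'M[R]_2) :
  char_poly M = 'X^2 - (\tr M)%:P * 'X + (\det M)%:P.
Proof.
rewrite /char_poly !det_mx22 mxtrace2 !mxE /= !mulr1n !mulr0n !sub0r.
rewrite polyCB !polyCM polyCD; ring.
Qed.

Lemma symmx_tr (R : realType) (n : nat) (X : symmx R n) :
  (symmx_val X)^T = symmx_val X.
Proof. exact/eqP/(symmx_valP X). Qed.

Lemma symmxC (R : realType) (n : nat) (X : symmx R n) (i j : 'I_n) :
  X i j = X j i.
Proof. by rewrite -{1}symmx_tr mxE. Qed.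

Lemma symmx2_eq (R : realType) (X Y : symmx R 2) :
  X 0 0 = Y 0 0 -> X 0 1 = Y 0 1 -> X 1 1 = Y 1 1 -> X = Y.
Proof.
have ord2 (i : 'I_2) : i = 0 \/ i = 1.
  by case: i => [[|[|//]] hi]; [left|right]; apply: val_inj.
move=> e00 e01 e11; apply: val_inj; apply/matrixP => i j.
by case: (ord2 i) (ord2 j) => -> [] ->; rewrite // !(symmxC _ 1 0).
Qed.

Lemma mx2_sym (R : realType) (x z w : R) :
  \matrix_(i < 2, j < 2) (if i != j then z else if i == 0 then x else w)
    \in is_symmx R 2.
Proof.
rewrite unfold_in; apply/eqP/matrixP => i j; rewrite !mxE eq_sym.
by case: eqVneq => // ->.
Qed.

Definition symmx2 (R : realType) (x z w : R) : symmx R 2 :=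
  SymMx (mx2_sym x z w).

Lemma symmx2_entries (R : realType) (x z w : R) :
  (symmx2 x z w 0 0 = x) * (symmx2 x z w 0 1 = z) * (symmx2 x z w 1 1 = w).
Proof. by rewrite !mxE. Qed.

Lemma quad2E (R : realType) (X : symmx R 2) (v : 'cV[R]_2) :
  (v^T *m X *m v) 0 0 =
  X 0 0 * v 0 0 ^+ 2 + X 0 1 * (v 0 0 * v 1 0) *+ 2 + X 1 1 * v 1 0 ^+ 2.
Proof.
have X10 : X 1 0 = X 0 1 := symmxC X 1 0.
rewrite !mxE !big_ord_recl !big_ord0 !mxE !big_ord_recl !big_ord0 !mxE.
rewrite !lift00 X10.
ring.
Qed.

Lemma psd2P (R : realType) (X : symmx R 2) :
  psd X <-> [/\ 0 <= X 0 0, 0 <= X 1 1 & X 0 1 ^+ 2 <= X 0 0 * X 1 1].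
Proof.
set x := X 0 0; set z := X 0 1; set w := X 1 1.
split=> [psdX|[x0 w0 zxw] v]; last first.
  rewrite quad2E -/x -/z -/w; set p := v 0 0; set q := v 1 0.
  have [x_eq0|xN0] := eqVneq x 0.
    have z0 : z = 0.
      by apply/eqP; rewrite -sqrf_eq0 eq_le sqr_ge0 andbT -(mul0r w) -x_eq0.
    by rewrite x_eq0 z0 !mul0r mul0rn !add0r mulr_ge0 ?sqr_ge0.
  have x_gt0 : 0 < x by rewrite lt_def xN0.
  (* Multiplying the form by [x > 0] allows completing the square without division. *)
  rewrite -(pmulr_rge0 _ x_gt0).
  have -> : x * (x * p ^+ 2 + z * (p * q) *+ 2 + w * q ^+ 2) =
    (x * p + z * q) ^+ 2 + (x * w - z ^+ 2) * q ^+ 2 by ring.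
  by rewrite addr_ge0 ?sqr_ge0 // mulr_ge0 ?sqr_ge0 // subr_ge0.
have q2 (p q : R) : 0 <= x * p ^+ 2 + z * (p * q) *+ 2 + w * q ^+ 2.
  have := psdX (\col_i if i == 0 then p else q).
  by rewrite quad2E !mxE.
have x0 : 0 <= x.
  by have := q2 1 0; rewrite expr1n expr0n /= !mulr0 mul0rn mulr1 !addr0.
have w0 : 0 <= w.
  have := q2 0 1; rewrite expr1n expr0n /= mul0r !mulr0.
  by rewrite mul0rn mulr1 !add0r.
split=> //; have [x_eq0|xN0] := eqVneq x 0; last first.
  have x_gt0 : 0 < x by rewrite lt_def xN0.
  (* At the vector [(- z, x)] the form equals [x * (x * w - z ^+ 2)]. *)
  rewrite -subr_ge0 -(pmulr_rge0 _ x_gt0).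
  by have := q2 (- z) x; congr (_ <= _); ring.
(* With [x = 0] this vector gives [- (w + 2) * z ^+ 2], and [w + 2 > 0] forces [z = 0]. *)
have := q2 (- (w + 1)) z; rewrite x_eq0 !mul0r add0r => h.
have {h} : 0 <= - (w + 2) * z ^+ 2 by move: h; congr (_ <= _); ring.
by rewrite mulNr oppr_ge0 pmulr_rle0 // ltr_wpDl.
Qed.

Lemma trip2E (R : realType) (X : symmx R 2) :
  trip X X = X 0 0 ^+ 2 + X 0 1 ^+ 2 *+ 2 + X 1 1 ^+ 2.
Proof.
have X10 : X 1 0 = X 0 1 := symmxC X 1 0.
rewrite /trip /mxtrace !big_ord_recl !big_ord0 !mxE !big_ord_recl !big_ord0.
rewrite !lift00 X10; ring.
Qed.

Lemma frobnorm2_sqr (R : realType) (X : symmx R 2) :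
  frobnorm X ^+ 2 = X 0 0 ^+ 2 + X 0 1 ^+ 2 *+ 2 + X 1 1 ^+ 2.
Proof.
by rewrite /frobnorm trip2E sqr_sqrtr // !addr_ge0 ?mulrn_wge0 ?sqr_ge0.
Qed.

(** The eigenvalues [a] and [b] of [X] are nonnegative, so the square roots of the eigenvalues
    [a ^+ 2] and [b ^+ 2] of [X^T *m X] are [a] and [b] again, and they add up to the trace. *)
Lemma nucnorm_psd2 (R : realType) (X : symmx R 2) :
  psd X -> nucnorm X = X 0 0 + X 1 1.
Proof.
move=> /psd2P[]; rewrite /nucnorm.
have X10 : X 1 0 = X 0 1 := symmxC X 1 0.
set x := X 0 0; set z := X 0 1; set w := X 1 1 => x0 w0 zxw.
(* The gap between the two eigenvalues of [X]: the square root of the discriminant of its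
   characteristic polynomial. *)
set d := Num.sqrt ((x - w) ^+ 2 + 4 * z ^+ 2).
have d2 : d ^+ 2 = (x - w) ^+ 2 + 4 * z ^+ 2.
  by rewrite sqr_sqrtr // addr_ge0 ?sqr_ge0 // mulr_ge0 ?sqr_ge0.
pose a := (x + w + d) / 2; pose b := (x + w - d) / 2.
have a0 : 0 <= a by rewrite divr_ge0 // !addr_ge0 ?sqrtr_ge0.
have b0 : 0 <= b.
  (* After squaring, [d <= x + w] is exactly [z ^+ 2 <= x * w]. *)
  rewrite divr_ge0 // subr_ge0 -ler_sqr ?nnegrE ?sqrtr_ge0 ?addr_ge0 //.
  by rewrite d2; nra.
have ab : a * b = x * w - z ^+ 2.
  have -> : a * b = ((x + w) ^+ 2 - d ^+ 2) / 4 by rewrite /a /b; field.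
  by rewrite d2; field.
have s2 : a ^+ 2 + b ^+ 2 = x ^+ 2 + w ^+ 2 + z ^+ 2 *+ 2.
  have -> : a ^+ 2 + b ^+ 2 = ((x + w) ^+ 2 + d ^+ 2) / 2.
    by rewrite /a /b; field.
  by rewrite d2; field.
have tr2 : \tr ((symmx_val X)^T *m X) = a ^+ 2 + b ^+ 2.
  by rewrite symmx_tr -/(trip X X) trip2E s2 -/x -/z -/w; ring.
have det2 : \det ((symmx_val X)^T *m X) = a ^+ 2 * b ^+ 2.
  by rewrite det_mulmx det_tr det_mx22 X10 -/x -/z -/w -exprMn ab; ring.
have -> : char_poly ((symmx_val X)^T *m X) =
    \prod_(c <- [:: a ^+ 2; b ^+ 2]) ('X - c%:P).
  rewrite char_poly_mx22 tr2 det2 big_cons big_seq1 polyCD polyCM; ring.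
rewrite sum_rootsR_prod_XsubC big_cons big_seq1 !sqrtr_sqr !ger0_norm //.
by rewrite /a /b; field.
Qed.

(** * The instance: its dual optima and its ALM minimizer *)

Definition symmx_diag (R : realType) (n : nat) (X : symmx R n) : 'cV[R]_n :=
  \col_i X i i.

Lemma symmx_diag_is_linear (R : realType) (n : nat) : linear (@symmx_diag R n).
Proof. by move=> a X Y; apply/colP => i; rewrite !mxE. Qed.

HB.instance Definition _ (R : realType) (n : nat) :=
  GRing.isLinear.Build R (symmx R n) 'cV[R]_n *:%R (@symmx_diag R n)
    (@symmx_diag_is_linear R n).

Definition ex_b (R : realType) : 'cV[R]_2 := \col_i (i == 0)%:R.
Definition ex_y (R : realType) (eps : R) : 'cV[R]_2 :=
  \col_i - (eps *+ (i == 1)).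
Definition ex_X (R : realType) : symmx R 2 := symmx2 1 0 0.

Lemma dotv2 (R : realType) (u v : 'cV[R]_2) :
  dotv u v = u 0 0 * v 0 0 + u 1 0 * v 1 0.
Proof.
by rewrite /dotv !big_ord_recl big_ord0 addr0 lift00.
Qed.

Lemma ex_auglagE (R : realType) (rho eps : R) (X : symmx R 2) :
  auglag 0 (@symmx_diag R 2) (ex_b R) rho X (ex_y eps) =
  eps * X 1 1 + rho / 2 * ((X 0 0 - 1) ^+ 2 + X 1 1 ^+ 2).
Proof.
have -> : auglag 0 (@symmx_diag R 2) (ex_b R) rho X (ex_y eps) =
  dotv (ex_y eps) (ex_b R - symmx_diag X) +
  rho / 2 * norm2 (symmx_diag X - ex_b R) ^+ 2.
  by rewrite /auglag /trip mul0mx mxtrace0 add0r.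
rewrite /norm2 sqr_sqrtr !dotv2 ?addr_ge0 -?expr2 ?sqr_ge0 // !mxE /=; ring.
Qed.

Lemma ex_psd_X (R : realType) : psd (ex_X R).
Proof. by apply/psd2P; rewrite !symmx2_entries expr0n /= mulr0. Qed.

Lemma ex_auglag_X (R : realType) (rho eps : R) :
  auglag 0 (@symmx_diag R 2) (ex_b R) rho (ex_X R) (ex_y eps) = 0.
Proof. rewrite ex_auglagE !symmx2_entries; ring. Qed.

(** The adjoint of the diagonal map builds the diagonal matrix of [y], so dual feasibility becomes a
    sign condition on each coordinate. *)
Lemma ex_adjointE (R : realType) (y : 'cV[R]_2) :
  let S := 0 - adjoint (@symmx_diag R 2) y in
  [/\ S 0 0 = - y 0 0, S 0 1 = 0 & S 1 1 = - y 1 0].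
Proof.
by split; rewrite !mxE dotv2 !mxE /= ?sub0r -?[2^-1 *+ 2]mulr_natl; field.
Qed.

(** The dual objective is the first coordinate, which feasibility keeps nonpositive; the second
    coordinate is free to be any [- eps] with [eps >= 0]. *)
Lemma ex_dual_optimal (R : realType) (eps : R) :
  0 <= eps -> dual_optimal 0 (@symmx_diag R 2) (ex_b R) (ex_y eps).
Proof.
move=> eps0; split=> [|y' /psd2P].
  apply/psd2P; have [-> -> ->] := ex_adjointE (ex_y eps).
  by rewrite !mxE /= mulr0n mulr1n !oppr0 !opprK expr0n mul0r lexx.
have [-> _ _] := ex_adjointE y'; rewrite oppr_ge0 => -[y0 _ _].
by rewrite !dotv2 !mxE /= mulr0n !oppr0; lra.
Qed.

Lemma ex_unique_minimizer (R : realType) (rho eps : R) :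
  0 < rho -> 0 <= eps ->
  alm_unique_minimizer 0 (@symmx_diag R 2) (ex_b R) rho (ex_y eps) (ex_X R).
Proof.
move=> rho0 eps0; split=> [|Z [psdZ minZ]].
  split=> [|Z /psd2P[x0 w0 _]]; first exact: ex_psd_X.
  rewrite ex_auglag_X ex_auglagE addr_ge0 ?mulr_ge0 // ?invr_ge0 ?(ltW rho0) //.
  by rewrite addr_ge0 ?sqr_ge0.
have := minZ _ (@ex_psd_X R); rewrite ex_auglag_X ex_auglagE.
have [x0 w0 zxw] := (psd2P Z).1 psdZ => le0.
have r0 : 0 < rho / 2 by rewrite divr_gt0.
have ew0 : 0 <= eps * Z 1 1 by rewrite mulr_ge0.
(* The quadratic penalty alone pins down the diagonal, so the argument also covers [eps = 0]. *)
have sq_le0 : (Z 0 0 - 1) ^+ 2 + Z 1 1 ^+ 2 <= 0.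
  by rewrite -(pmulr_rle0 _ r0); lra.
have [/eqP hx hw] : (Z 0 0 - 1) ^+ 2 = 0 /\ Z 1 1 ^+ 2 = 0.
  by have := sqr_ge0 (Z 0 0 - 1); have := sqr_ge0 (Z 1 1); split; lra.
have {hw}/eqP w_eq0 : Z 1 1 == 0 by rewrite -sqrf_eq0 hw.
have z_eq0 : Z 0 1 = 0.
  apply/eqP; rewrite -sqrf_eq0 eq_le sqr_ge0 andbT (le_trans zxw) //.
  by rewrite w_eq0 mulr0.
apply: symmx2_eq; rewrite !symmx2_entries //.
by apply/eqP; rewrite -subr_eq0 -sqrf_eq0.
Qed.

Lemma ex_frobnormE (R : realType) (X : symmx R 2) :
  frobnorm (X - ex_X R) ^+ 2 =
  (X 0 0 - 1) ^+ 2 + X 0 1 ^+ 2 *+ 2 + X 1 1 ^+ 2.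
Proof. by rewrite frobnorm2_sqr !mxE /= !subr0. Qed.

Lemma ex_nucnorm_X (R : realType) : nucnorm (ex_X R) = 1.
Proof. by rewrite (nucnorm_psd2 (@ex_psd_X R)) !symmx2_entries addr0. Qed.

(** * Lower and upper bounds on growth constants, and the limit *)

(** The factor [rho / 2] lets the penalty pay for the diagonal part of the distance; [eps / (2 * B)]
    lets the linear term pay for the off-diagonal part, which is at most [2 * B * X 1 1]. *)
Lemma ex_qg_constant (R : realType) (rho eps B : R) :
  0 < rho -> 0 < eps -> 0 < B ->
  qg_constant 0 (@symmx_diag R 2) (ex_b R) rho (ex_y eps) (ex_X R) B
    (Num.min (rho / 2) (eps / (2 * B))).
Proof.
move=> rho0 eps0 B0; set g := Num.min _ _.
have g0 : 0 < g by rewrite lt_min !divr_gt0 ?mulr_gt0.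
have g1 : g <= rho / 2 by rewrite ge_min lexx.
have g2 : g * (2 * B) <= eps.
  by rewrite -ler_pdivlMr ?mulr_gt0 // ge_min lexx orbT.
split=> // X psdX; rewrite nucnorm_psd2 // => trB.
have [x0 w0 zxw] := (psd2P X).1 psdX.
rewrite ex_auglag_X subr0 ex_auglagE ex_frobnormE.
(* The nuclear norm is the trace here, so its bound gives [X 0 0 <= B]. *)
have zB : X 0 1 ^+ 2 <= B * X 1 1.
  by rewrite (le_trans zxw) // ler_wpM2r //; lra.
have h1 : g * (X 0 1 ^+ 2 *+ 2) <= eps * X 1 1.
  rewrite (@le_trans _ _ (g * (2 * B) * X 1 1)) ?ler_wpM2r // -mulrA.
  by rewrite ler_wpM2l ?(ltW g0) // -mulr_natl -mulrA ler_pM2l.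
have h2 : g * ((X 0 0 - 1) ^+ 2 + X 1 1 ^+ 2)
          <= rho / 2 * ((X 0 0 - 1) ^+ 2 + X 1 1 ^+ 2).
  by rewrite ler_wpM2r // addr_ge0 ?sqr_ge0.
lra.
Qed.

(* Test along the curve t |-> [[1, sqrt t], [sqrt t, t]], whose squared distance
   to the minimizer is of order t while the penalty is of order t^2. *)
Lemma ex_qg_constant_le (R : realType) (rho eps B gamma : R) :
  0 < rho -> 1 < B ->
  qg_constant 0 (@symmx_diag R 2) (ex_b R) rho (ex_y eps) (ex_X R) B gamma ->
  gamma <= eps / 2.
Proof.
move=> rho0 B1 [g0 growth]; rewrite leNgt; apply/negP => lt_g.
(* The first bound keeps the trace [1 + t] within [B]. The second makes [rho * t / 2] at most half
   of the gap [2 * gamma - eps], too little for the growth inequality once it is divided by [t]. *)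
pose t := Num.min (B - 1) ((2 * gamma - eps) / rho).
have d0 : 0 < 2 * gamma - eps by lra.
have t0 : 0 < t by rewrite lt_min subr_gt0 B1 divr_gt0.
have tB : t <= B - 1 by rewrite ge_min lexx.
have td : rho * t <= 2 * gamma - eps.
  by rewrite mulrC -ler_pdivlMr // ge_min lexx orbT.
pose X := symmx2 1 (Num.sqrt t) t.
have psdX : psd X.
  by apply/psd2P; rewrite !symmx2_entries sqr_sqrtr ?(ltW t0) // mul1r.
have := growth X psdX; rewrite nucnorm_psd2 // ex_auglag_X ex_auglagE.
rewrite ex_frobnormE !symmx2_entries sqr_sqrtr ?(ltW t0) // subrr expr0n /=.
rewrite !add0r subr0 => /(_ ltac:(lra)).
have -> : gamma * (t *+ 2 + t ^+ 2) = t * (gamma * (2 + t)) by ring.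
have -> : eps * t + rho / 2 * t ^+ 2 = t * (eps + rho * t / 2) by field.
rewrite ler_pM2l // => h; have gt0 : 0 < gamma * t by rewrite mulr_gt0.
lra.
Qed.

Theorem mainTheorem6 (R : realType) :
  exists (n m : nat) (C : symmx R n) (A : {linear symmx R n -> 'cV[R]_m})
    (b : 'cV[R]_m),
  forall rho : R, 0 < rho ->
  exists (y : R -> 'cV[R]_m) (Xs : symmx R n),
    (forall eps : R, 0 <= eps < rho ->
       dual_optimal C A b (y eps) /\
       alm_unique_minimizer C A b rho (y eps) Xs) /\
    (forall B : R, nucnorm Xs < B ->
       (forall eps : R, 0 < eps < rho ->
          (0 < best_qg_constant C A b rho (y eps) Xs B)%E) /\
       best_qg_constant C A b rho (y eps) Xs B @[eps --> 0^'+] --> 0%E /\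
       ~ exists gamma : R, qg_constant C A b rho (y 0) Xs B gamma).
Proof.
exists 2, 2, 0, (@symmx_diag R 2), (ex_b R) => rho rho0.
exists (@ex_y R), (ex_X R); split=> [eps /andP[eps0 _]|B].
  by split; [exact: ex_dual_optimal|exact: ex_unique_minimizer].
rewrite ex_nucnorm_X => B1.
have best_gt0 (eps : R) : 0 < eps ->
    (0 < best_qg_constant 0%R (@symmx_diag R 2) (ex_b R) rho (ex_y eps)
           (ex_X R) B)%E.
  move=> eps0; have qg := ex_qg_constant rho0 eps0 (lt_trans ltr01 B1).
  apply: (@lt_le_trans _ _ (Num.min (rho / 2) (eps / (2 * B)))%:E).
    by rewrite lte_fin; case: qg.
  by apply: ereal_sup_ubound; exists (Num.min (rho / 2) (eps / (2 * B))).
split=> [eps /andP[eps0 _]|]; first exact: best_gt0.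
split=> [|[gamma qg]]; last first.
  (* At [eps = 0] the upper bound reads [gamma <= 0]. *)
  by have := ex_qg_constant_le rho0 B1 qg; case: qg => + _; rewrite mul0r; lra.
(* The lower bound [0] relies on growth constants existing for [eps > 0]: the supremum of an empty
   set would be [-oo]. *)
apply: (@squeeze_cvge _ _ _ _ (fun=> 0%E) _ (fun eps : R => (eps / 2)%:E)).
- near=> eps; have eps0 : 0 < eps by near: eps; exact: nbhs_right_gt.
  apply/andP; split; first exact/ltW/best_gt0.
  apply: ge_ereal_sup => _ [gamma qg <-].
  by rewrite lee_fin (ex_qg_constant_le rho0 B1 qg).
- exact: cvg_cst.
- apply: cvg_EFin; first by near=> eps.
  have : eps / 2 @[eps --> (0 : R)^'+] --> (0 / 2 : R).
    by apply: cvgMr_tmp; apply: cvg_at_right_filter; exact: cvg_id.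
  by rewrite mul0r.
Unshelve. all: by end_near. Qed.
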